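(* Let $K$ be any field (of any characteristic), let $f$ be a smooth mapping from the $n$-germ to the $m$-germ and $g$ a smooth mapping from the $m$-germ to the $p$-germ over $K$. Let $I$ be a finite set and $v_i\in K^n$ for $i\in I$. Then $$\left\langle (g\circ f)^{(|I|)}(0),\bigotimes_{i\in I} v_i\right\rangle=\sum_{\pi\in\mathcal{H}(I)}\left\langle g^{(|\pi|)}(0),\bigotimes_{S\in\pi}\left\langle f^{(|S|)}(0),\bigotimes_{i\in S}v_i\right\rangle\right\rangle\quad\text{in }K^p .$$
   Context: For $n\in\mathbf{N}$ (non-negative integers) let $\mathcal{A}_n=K[[T_1,\dots,T_n]]$ (formal power series), with the linear topology whose basic neighborhoods of $0$ are the positive integer powers of the ideal of series without constant term. A smooth mapping $f$ from the $n$-germ to the $m$-germ is given by a continuous (unital) $K$-algebra homomorphism $\phi_f:\mathcal{A}_m\to\mathcal{A}_n$; its components are $f_j=\phi_f(T_j)\in\mathcal{A}_n$, $j=1,\dots,m$ (by continuity these have zero constant term, i.e. $f(0)=0$). The composition $g\circ f$ is the smooth mapping with $\phi_{g\circ f}=\phi_f\circ\phi_g$. For $v=(c_1,\dots,c_n)\in K^n$ and $F\in\mathcal{A}_n$, the directional derivative of $F$ in direction $v$ is $\sum_{l}c_l\,\partial F/\partial T_l$ (formal partial derivatives). For $F\in\mathcal{A}_n$, $\langle F^{(k)}(0),v_1\otimes\dots\otimes v_k\rangle\in K$ is the constant term of the series obtained from $F$ by applying successively the directional derivatives in directions $v_1,\dots,v_k$; it is symmetric and multilinear in the $v_i$, so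 $F^{(k)}(0)$ is a linear map $S^k(K^n)\to K$. For a smooth mapping $f$ from the $n$-germ to the $m$-germ, $f^{(k)}(0):S^k(K^n)\to K^m$ is the linear map with $j$-th component $f_j^{(k)}(0)$. $S^k(V)$ is the symmetric power of the vector space $V$: the quotient of the $k$-fold tensor product by the span of all $x_1\otimes\dots\otimes x_k-x_{\sigma(1)}\otimes\dots\otimes x_{\sigma(k)}$, $\sigma$ a permutation; the image of $x_1\otimes\dots\otimes x_k$ is denoted by the same symbol, so $\bigotimes_{i\in I}x_i\in S^{|I|}(V)$ makes sense for a finite family. $S^0(V)=K$. $\langle T,\cdot\rangle$ denotes evaluation of a linear map $T$. $|I|$ is cardinality, and $\mathcal{H}(I)$ is the set of partitions of $I$: collections $\pi$ of pairwise disjoint non-empty subsets of $I$ with union $I$ (so $\mathcal{H}(\emptyset)=\{\emptyset\}$). *)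

(* Defs.v *)
From HB Require Import structures.
From mathcomp Require Import all_boot all_order all_fingroup all_algebra.
From mathcomp Require Import generic_quotient ring_quotient.
From mathcomp Require Import boolp classical_sets topology.
From mathcomp Require Import freeg mpoly.

Set Implicit Arguments.
Unset Strict Implicit.
Unset Printing Implicit Defensive.

Import GRing.Theory.

Local Open Scope classical_set_scope.
Local Open Scope ring_scope.

(** * Formal power series in n variables *)

Record fps (R : comNzRingType) (n : nat) := Fps { fcoef : 'X_{1..n} -> R }.

Notation "{ 'fps' R [ n ] }" := (fps R n)
  (at level 0, R, n at level 2, format "{ 'fps'  R [ n ] }") : type_scope.

HB.instance Definition _ R n := gen_eqMixin {fps R[n]}.
HB.instance Definition _ R n := gen_choiceMixin {fps R[n]}.

Section FpsAlgebra.
Context (R : comNzRingType) (n : nat).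
Implicit Types (F G H : {fps R[n]}) (m k : 'X_{1..n}) (a b : R).

Lemma fpsP F G : fcoef F =1 fcoef G <-> F = G.
Proof.
split=> [eqFG|-> //]; case: F G eqFG => [F] [G] /= eqFG.
by congr Fps; apply/funext.
Qed.

Definition fps_zero := @Fps R n (fun _ => 0).
Definition fps_opp F := Fps (fun m => - fcoef F m).
Definition fps_add F G := Fps (fun m => fcoef F m + fcoef G m).
Definition fps_one := @Fps R n (fun m => (m == 0%MM)%:R).
Definition fps_scale a F := Fps (fun m => a * fcoef F m).
Definition fps_mul F G := Fps (fun m =>
  \sum_(k : 'X_{1..n < (mdeg m).+1, (mdeg m).+1} | m == (k.1 + k.2)%MM)
    fcoef F k.1 * fcoef G k.2).

Lemma fps_addA : associative fps_add.
Proof. by move=> F G H; apply/fpsP => m /=; rewrite addrA. Qed.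

Lemma fps_addC : commutative fps_add.
Proof. by move=> F G; apply/fpsP => m /=; rewrite addrC. Qed.

Lemma fps_add0 : left_id fps_zero fps_add.
Proof. by move=> F; apply/fpsP => m /=; rewrite add0r. Qed.

Lemma fps_addN : left_inverse fps_zero fps_opp fps_add.
Proof. by move=> F; apply/fpsP => m /=; rewrite addNr. Qed.

HB.instance Definition _ :=
  GRing.isZmodule.Build {fps R[n]} fps_addA fps_addC fps_add0 fps_addN.

Definition fps_trunc d F : {mpoly R[n]} :=
  \sum_(m : 'X_{1..n < d}) fcoef F m *: 'X_[m].

Lemma mcoeff_fps_trunc d F m : (mdeg m < d)%N -> (fps_trunc d F)@_m = fcoef F m.
Proof. by move=> lt_md; rewrite /fps_trunc (mcoeff_mpoly (fcoef F)). Qed.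

Lemma fcoef_mul (F G : {fps R[n]}) (p q : {mpoly R[n]}) m :
    (forall k, (mdeg k <= mdeg m)%N -> p@_k = fcoef F k) ->
    (forall k, (mdeg k <= mdeg m)%N -> q@_k = fcoef G k) ->
  fcoef (fps_mul F G) m = (p * q)@_m.
Proof.
move=> pF qG; rewrite mcoeffM /=; apply: eq_bigr => -[k1 k2] _ /=.
by rewrite pF ?qG // -ltnS bmdeg.
Qed.

Lemma fcoef_mul_trunc d F G m : (mdeg m < d)%N ->
  fcoef (fps_mul F G) m = (fps_trunc d F * fps_trunc d G)@_m.
Proof.
by move=> lt_md; apply: fcoef_mul => k lekm;
  rewrite mcoeff_fps_trunc // (leq_ltn_trans lekm).
Qed.

Lemma fps_mulA : associative fps_mul.
Proof.
move=> F G H; apply/fpsP => m; pose t := fps_trunc (mdeg m).+1.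
have tE K k : (mdeg k <= mdeg m)%N -> (t K)@_k = fcoef K k.
  by move=> lekm; rewrite mcoeff_fps_trunc.
have tM K L k : (mdeg k <= mdeg m)%N -> (t K * t L)@_k = fcoef (fps_mul K L) k.
  by move=> lekm; rewrite (@fcoef_mul_trunc (mdeg m).+1).
by rewrite (fcoef_mul (tE F) (tM G H)) (fcoef_mul (tM F G) (tE H)) mulrA.
Qed.

Lemma fps_mulC : commutative fps_mul.
Proof.
move=> F G; apply/fpsP => m.
by rewrite !(@fcoef_mul_trunc (mdeg m).+1) // mulrC.
Qed.

Lemma mcoeff1_fps m : (1 : {mpoly R[n]})@_m = fcoef fps_one m.
Proof. by rewrite mcoeff1. Qed.

Lemma fps_mul1 : left_id fps_one fps_mul.
Proof.
move=> F; apply/fpsP => m.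
rewrite (fcoef_mul (fun k _ => mcoeff1_fps k)
  (fun k lekm => @mcoeff_fps_trunc (mdeg m).+1 F k lekm)).
by rewrite mul1r mcoeff_fps_trunc.
Qed.

Lemma fps_mulDl : left_distributive fps_mul fps_add.
Proof.
move=> F G H; apply/fpsP => m /=; rewrite -big_split.
by apply: eq_bigr => k _; rewrite mulrDl.
Qed.

Lemma fps_one_neq0 : fps_one != 0 :> {fps R[n]}.
Proof.
apply/eqP => /fpsP/(_ 0%MM) /=; rewrite eqxx => /eqP.
by rewrite oner_eq0.
Qed.

HB.instance Definition _ := GRing.Zmodule_isComNzRing.Build {fps R[n]}
  fps_mulA fps_mulC fps_mul1 fps_mulDl fps_one_neq0.

Lemma fps_scaleA a b F : fps_scale a (fps_scale b F) = fps_scale (a * b) F.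
Proof. by apply/fpsP => m /=; rewrite mulrA. Qed.

Lemma fps_scale1 : left_id 1 fps_scale.
Proof. by move=> F; apply/fpsP => m /=; rewrite mul1r. Qed.

Lemma fps_scaleDr : right_distributive fps_scale +%R.
Proof. by move=> a F G; apply/fpsP => m /=; rewrite mulrDr. Qed.

Lemma fps_scaleDl F : {morph fps_scale^~ F : a b / a + b}.
Proof. by move=> a b; apply/fpsP => m /=; rewrite mulrDl. Qed.

HB.instance Definition _ := GRing.Zmodule_isLmodule.Build R {fps R[n]}
  fps_scaleA fps_scale1 fps_scaleDr fps_scaleDl.

Lemma fps_scaleAl a F G : a *: (F * G) = a *: F * G.
Proof.
apply/fpsP => m /=; rewrite mulr_sumr.
by apply: eq_bigr => k _; rewrite mulrA.
Qed.

HB.instance Definition _ :=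
  GRing.Lmodule_isLalgebra.Build R {fps R[n]} fps_scaleAl.
HB.instance Definition _ := GRing.Lalgebra_isComAlgebra.Build R {fps R[n]}.

Lemma fcoef0 m : fcoef (0 : {fps R[n]}) m = 0. Proof. by []. Qed.
Lemma fcoef1 m : fcoef (1 : {fps R[n]}) m = (m == 0%MM)%:R. Proof. by []. Qed.
Lemma fcoefN F m : fcoef (- F) m = - fcoef F m. Proof. by []. Qed.
Lemma fcoefD F G m : fcoef (F + G) m = fcoef F m + fcoef G m.
Proof. by []. Qed.
Lemma fcoefZ a F m : fcoef (a *: F) m = a * fcoef F m. Proof. by []. Qed.
Lemma fcoefM F G m : fcoef (F * G) m =
  \sum_(k : 'X_{1..n < (mdeg m).+1, (mdeg m).+1} | m == (k.1 + k.2)%MM)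
    fcoef F k.1 * fcoef G k.2.
Proof. by []. Qed.

Lemma fcoef_sum (I : Type) (r : seq I) (P : pred I) (E : I -> {fps R[n]}) m :
  fcoef (\sum_(i <- r | P i) E i) m = \sum_(i <- r | P i) fcoef (E i) m.
Proof. by elim/big_rec2: _ => // i y x _ <-. Qed.

Definition fps_var (i : 'I_n) : {fps R[n]} := Fps (fun m => (m == U_(i)%MM)%:R).

Definition fps_const_term F : R := fcoef F 0%MM.

Definition fps_max_ideal : set {fps R[n]} := [set F | fps_const_term F = 0].

End FpsAlgebra.

(** * The linear topology defined by the powers of the maximal ideal *)

(* The ideal generated by the r-fold products of elements of I. *)
Definition ideal_power (A : comNzRingType) (I : set A) (r : nat) : set A :=
  [set x | exists2 s : seq (A * r.-tuple A),
     (forall p, p \in s -> forall y, y \in p.2 -> I y)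
     & x = \sum_(p <- s) p.1 * \prod_(y <- p.2) y].

Section IdealPower.
Context (A : comNzRingType) (I : set A).

Lemma ideal_power0 r : ideal_power I r 0.
Proof. by exists [::]; rewrite ?big_nil. Qed.

Lemma ideal_powerD r x y :
  ideal_power I r x -> ideal_power I r y -> ideal_power I r (x + y).
Proof.
move=> [s Is ->] [t It ->]; exists (s ++ t); rewrite ?big_cat // => p.
by rewrite mem_cat => /orP[/Is|/It].
Qed.

Lemma ideal_power_leq r s x :
  (r <= s)%N -> ideal_power I s x -> ideal_power I r x.
Proof.
move=> /subnKC <-; elim: {s}(s - r)%N x => [|d IHd] x; first by rewrite addn0.
rewrite addnS => -[s Is ->]; apply: IHd.
exists [seq (p.1 * thead p.2, [tuple of behead p.2]) | p <- s].
  move=> _ /mapP[p ps ->] /= y yp; apply: (Is p ps).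
  by rewrite mem_behead.
rewrite big_map; apply: eq_bigr => -[a t] _ /=.
by case/tupleP: t => y t /=; rewrite theadE big_cons mulrA.
Qed.

End IdealPower.

Section FpsTopology.
Context (R : comNzRingType) (n : nat).
Local Notation A := {fps R[n]}.

(* The basic neighbourhoods of F are the cosets F + M^r with r > 0, where M is
   the ideal of series without constant term. *)
Definition fps_nbhs (F : A) : set_system A := [set U |
  exists2 r : nat, (0 < r)%N
    & forall G, ideal_power (@fps_max_ideal R n) r G -> U (F + G)].

HB.instance Definition _ := hasNbhs.Build A fps_nbhs.

Lemma fps_nbhs_filter (F : A) : ProperFilter (nbhs F).
Proof.
apply: Build_ProperFilter_ex => [U [r _ UF]|].
  by exists (F + 0); apply: UF; apply: ideal_power0.
split.
- by exists 1%N.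
- move=> U V [r r0 UF] [s s0 VF]; exists (maxn r s).
    by rewrite leq_max r0.
  move=> G mG; split.
    by apply: UF; apply: ideal_power_leq mG; rewrite leq_maxl.
  by apply: VF; apply: ideal_power_leq mG; rewrite leq_maxr.
- by move=> U V UV [r r0 UF]; exists r => // G /UF/UV.
Qed.

Lemma fps_nbhs_singleton (F : A) (U : set A) : nbhs F U -> U F.
Proof. by move=> [r _ UF]; rewrite -[F]addr0; apply/UF/ideal_power0. Qed.

Lemma fps_nbhs_nbhs (F : A) (U : set A) : nbhs F U -> nbhs F (nbhs^~ U).
Proof.
move=> [r r0 UF]; exists r => // G mG; exists r => // H mH.
by rewrite -addrA; apply/UF/ideal_powerD.
Qed.

HB.instance Definition _ := Nbhs_isNbhsTopological.Build A
  fps_nbhs_filter fps_nbhs_singleton fps_nbhs_nbhs.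

End FpsTopology.

(** * Smooth mappings between germs *)

(* A mapping from the n-germ to the m-germ acts contravariantly on series; being
   an [lrmorphism] makes the action K-linear, multiplicative and unital. *)
Record smooth_map (K : fieldType) (n m : nat) := SmoothMap {
  pullback : {lrmorphism {fps K[m]} -> {fps K[n]}};
  pullback_continuous : continuous pullback
}.

Section SmoothMap.
Context (K : fieldType).

Definition smooth_component n m (f : smooth_map K n m) (j : 'I_m) : {fps K[n]} :=
  pullback f (fps_var K j).

Section Comp.
Context (n m p : nat) (g : smooth_map K m p) (f : smooth_map K n m).

Definition comp_pullback : {lrmorphism {fps K[p]} -> {fps K[n]}} :=
  pullback f \o pullback g.

Lemma comp_pullback_continuous : continuous comp_pullback.
Proof.
by move=> F; apply: continuous_comp; exact: pullback_continuous.
Qed.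

Definition smooth_comp : smooth_map K n p := SmoothMap comp_pullback_continuous.

End Comp.
End SmoothMap.

(** * Quotient of a module by the submodule spanned by a set *)

Section SpanQuotient.
Context (K : nzRingType) (V : lmodType K) (S : set V).

Definition in_span : pred V := fun x => `[<
  exists2 s : seq (K * V), (forall p, p \in s -> S p.2)
    & x = \sum_(p <- s) p.1 *: p.2 >].

Lemma in_spanP x : reflect (exists2 s : seq (K * V),
  (forall p, p \in s -> S p.2) & x = \sum_(p <- s) p.1 *: p.2) (in_span x).
Proof. exact: asboolP. Qed.

Lemma mem_span x : S x -> in_span x.
Proof.
move=> Sx; apply/in_spanP; exists [:: (1, x)]; last by rewrite big_seq1 scale1r.
by move=> p; rewrite inE => /eqP ->.
Qed.

Lemma in_spanZ a x : in_span x -> in_span (a *: x).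
Proof.
move=> /in_spanP[s Ss ->]; apply/in_spanP; exists [seq (a * p.1, p.2) | p <- s].
  by move=> _ /mapP[p ps ->]; exact: (Ss p ps).
by rewrite big_map scaler_sumr; apply: eq_bigr => p _; rewrite scalerA.
Qed.

Lemma in_spanD x y : in_span x -> in_span y -> in_span (x + y).
Proof.
move=> /in_spanP[s Ss ->] /in_spanP[t St ->]; apply/in_spanP; exists (s ++ t).
  by move=> p; rewrite mem_cat => /orP[/Ss|/St].
by rewrite big_cat.
Qed.

Lemma in_span_zmod : zmod_closed in_span.
Proof.
split=> [|x y Sx Sy]; first by apply/in_spanP; exists [::]; rewrite ?big_nil.
by rewrite -scaleN1r; apply: in_spanD => //; apply: in_spanZ.
Qed.

HB.instance Definition _ := GRing.isZmodClosed.Build V in_span in_span_zmod.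

Definition span_quot := Quotient.quot [the zmodClosed V of in_span : {pred V}].

HB.instance Definition _ := GRing.Zmodule.on span_quot.
HB.instance Definition _ := Quotient.on span_quot.
HB.instance Definition _ := EqQuotient.on span_quot.

Local Open Scope quotient_scope.

Definition span_pi (x : V) : span_quot := \pi_span_quot x.

Lemma span_pi_eq x y : span_pi x = span_pi y <-> in_span (x - y).
Proof.
have e := Quotient.idealrBE [the zmodClosed V of in_span : {pred V}] x y.
by split=> [/eqP xy|Sxy]; [rewrite -[in_span _]/(_ \in in_span) e | apply/eqP; rewrite -e].
Qed.

Lemma span_pi_repr (q : span_quot) : span_pi (repr q) = q.
Proof. exact: reprK. Qed.

Lemma span_piD x y : span_pi (x + y) = span_pi x + span_pi y.
Proof. exact: (Quotient.pi_add [the zmodClosed V of in_span : {pred V}] x y). Qed.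

Definition span_scale (a : K) (q : span_quot) := span_pi (a *: repr q).

Lemma span_piZ a x : span_pi (a *: x) = span_scale a (span_pi x).
Proof.
apply/span_pi_eq; rewrite -scalerBr; apply: in_spanZ; apply/span_pi_eq.
by rewrite span_pi_repr.
Qed.

Lemma span_scaleA a b q : span_scale a (span_scale b q) = span_scale (a * b) q.
Proof. by rewrite -(span_pi_repr q) -!span_piZ scalerA. Qed.

Lemma span_scale1 : left_id 1 span_scale.
Proof. by move=> q; rewrite -(span_pi_repr q) -span_piZ scale1r. Qed.

Lemma span_scaleDr : right_distributive span_scale +%R.
Proof.
move=> a q r; rewrite -(span_pi_repr q) -(span_pi_repr r).
by rewrite -span_piD -!span_piZ -span_piD scalerDr.
Qed.

Lemma span_scaleDl q : {morph span_scale^~ q : a b / a + b}.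
Proof.
by move=> a b; rewrite -(span_pi_repr q) -!span_piZ -span_piD scalerDl.
Qed.

HB.instance Definition _ := GRing.Zmodule_isLmodule.Build K span_quot
  span_scaleA span_scale1 span_scaleDr span_scaleDl.

Lemma span_pi_is_linear : linear span_pi.
Proof. by move=> a x y; rewrite span_piD span_piZ. Qed.

HB.instance Definition _ :=
  GRing.isLinear.Build K V span_quot *:%R span_pi span_pi_is_linear.

Section Lift.
Context (W : lmodType K) (h : {linear V -> W}) (hS : forall x, S x -> h x = 0).

Definition span_lift (_ : forall x, S x -> h x = 0) (q : span_quot) : W :=
  h (repr q).

Lemma span_lift_pi x : span_lift hS (span_pi x) = h x.
Proof.
apply/eqP; rewrite -subr_eq0 -linearB; apply/eqP.
have /span_pi_eq/in_spanP[s Ss ->] := span_pi_repr (span_pi x).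
rewrite linear_sum big_seq big1 // => p /Ss/hS hp.
by rewrite linearZ /= hp scaler0.
Qed.

Lemma span_lift_is_linear : linear (span_lift hS).
Proof.
move=> a q r; rewrite -(span_pi_repr q) -(span_pi_repr r).
by rewrite -linearP !span_lift_pi linearP.
Qed.

HB.instance Definition _ :=
  GRing.isLinear.Build K span_quot W *:%R (span_lift hS) span_lift_is_linear.

End Lift.
End SpanQuotient.

Arguments span_pi {K V S} : simpl never.
Arguments span_lift {K V S W h} _ _ : simpl never.

Section FreegLift.
Context (K : nzRingType) (T : choiceType) (W : lmodType K) (h : T -> W).

Lemma fglift_is_linear : linear (fglift h : {freeg T / K} -> W).
Proof.
pose hA := GRing.isAdditive.Build {freeg T / K} W (fglift h) (lift_is_additive h).
pose L : {additive {freeg T / K} -> W} := HB.pack (fglift h) hA.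
move=> a x y; rewrite -[fglift h _]/(L _) -[fglift h x]/(L x) -[fglift h y]/(L y).
rewrite raddfD; congr (_ + _).
rewrite -[x]freeg_sumE scaler_sumr raddf_sum [in RHS]raddf_sum scaler_sumr.
apply: eq_bigr => z _.
have -> : a *: << coeff z x *g z >> = << a * coeff z x *g z >> :> {freeg T / K}.
  by apply/eqP/freeg_eqP => t; rewrite coeffZ !coeffU mulrA.
by rewrite /= !liftU scalerA.
Qed.

HB.instance Definition _ := GRing.isLinear.Build K {freeg T / K} W *:%R
  (fglift h) fglift_is_linear.

End FreegLift.

(** * Tensor and symmetric powers *)

Section TensorPower.
Context (K : fieldType) (V : lmodType K) (k : nat).
Implicit Types (x : {ffun 'I_k -> V}).

Definition ffun_upd x (i : 'I_k) (u : V) : {ffun 'I_k -> V} :=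
  [ffun j => if j == i then u else x j].

Definition multilinear_relations : set {freeg {ffun 'I_k -> V} / K} :=
  [set z | exists x i a u w,
     z = << ffun_upd x i (a *: u + w) >>
         - (a *: << ffun_upd x i u >> + << ffun_upd x i w >>)].

(* The free module on the families (x_i)_(i < k), modulo multilinearity in each
   argument; for k = 0 there is one family and no relation. *)
Definition tensor_power := span_quot multilinear_relations.

HB.instance Definition _ := GRing.Lmodule.on tensor_power.

Definition tensor (x : 'I_k -> V) : tensor_power :=
  span_pi << [ffun i => x i] >>.

Definition symmetry_relations : set tensor_power :=
  [set z | exists (x : 'I_k -> V) (s : 'S_k),
     z = tensor x - tensor (fun i => x (s i))].

Definition sym_power := span_quot symmetry_relations.

HB.instance Definition _ := GRing.Lmodule.on sym_power.

Definition sym_tensor (x : 'I_k -> V) : sym_power := span_pi (tensor x).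

Definition multilinear (W : lmodType K) (h : {ffun 'I_k -> V} -> W) :=
  forall x i, linear (fun u => h (ffun_upd x i u)).

Definition symmetric_map (W : lmodType K) (h : {ffun 'I_k -> V} -> W) :=
  forall x (s : 'S_k), h [ffun i => x (s i)] = h x.

Section Lift.
Context (W : lmodType K) (h : {ffun 'I_k -> V} -> W).
Hypotheses (h_lin : multilinear h) (h_sym : symmetric_map h).

Lemma fglift_multilinear z : multilinear_relations z -> fglift h z = 0.
Proof.
move=> [x [i [a [u [w ->]]]]].
by rewrite linearB linearD linearZ /= !liftU !scale1r h_lin subrr.
Qed.

Definition tensor_lift : {linear tensor_power -> W} :=
  span_lift fglift_multilinear.

Lemma tensor_liftE (x : 'I_k -> V) : tensor_lift (tensor x) = h [ffun i => x i].
Proof. by rewrite [LHS]span_lift_pi /= liftU scale1r. Qed.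

Lemma tensor_lift_symmetric z : symmetry_relations z -> tensor_lift z = 0.
Proof.
move=> [x [s ->]]; rewrite linearB !tensor_liftE -(h_sym [ffun i => x i] s).
by apply/eqP; rewrite subr_eq0; apply/eqP; congr h; apply/ffunP => i; rewrite !ffunE.
Qed.

Definition sym_lift : {linear sym_power -> W} :=
  span_lift tensor_lift_symmetric.

Lemma sym_liftE (x : 'I_k -> V) : sym_lift (sym_tensor x) = h [ffun i => x i].
Proof. by rewrite [LHS]span_lift_pi tensor_liftE. Qed.

End Lift.
End TensorPower.

(* The factors are listed in the order of [enum A]; in the symmetric power the
   order is immaterial. *)
Definition bigtensor (K : fieldType) (V : lmodType K) (T : finType)
    (A : {set T}) (x : T -> V) : sym_power V #|A| :=
  sym_tensor (fun i : 'I_#|A| => x (enum_val i)).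

Notation "\bigotimes_ ( i 'in' A ) E" := (bigtensor A (fun i => E))
  (at level 36, E at level 36, i at level 50,
   format "\bigotimes_ ( i  'in'  A )  E") : ring_scope.

(** * Derivatives at the origin *)

Section Derivatives.
Context (K : fieldType) (n : nat).
Implicit Types (F G : {fps K[n]}) (v : 'rV[K]_n).

(* T_l^(m_l + 1) contributes (m_l + 1) T_l^(m_l). *)
Definition fps_deriv (l : 'I_n) F : {fps K[n]} :=
  Fps (fun m => fcoef F (m + U_(l))%MM *+ (m l).+1).

Definition dir_deriv v F : {fps K[n]} := \sum_l v 0 l *: fps_deriv l F.

Definition iter_dir_deriv (vs : seq 'rV[K]_n) F : {fps K[n]} :=
  foldl (fun G v => dir_deriv v G) F vs.

Lemma fps_deriv_is_linear l : linear (fps_deriv l).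
Proof.
by move=> a F G; apply/fpsP => m; rewrite !(fcoefD, fcoefZ) /= mulrnDl mulrnAr.
Qed.

HB.instance Definition _ l := GRing.isLinear.Build K {fps K[n]} {fps K[n]} *:%R
  (fps_deriv l) (fps_deriv_is_linear l).

Lemma fps_derivC l l' F :
  fps_deriv l (fps_deriv l' F) = fps_deriv l' (fps_deriv l F).
Proof.
apply/fpsP => m /=; have [-> //|neq] := eqVneq l l'.
rewrite -!addmA [(U_(l) + _)%MM]addmC !mnmDE !mnm1E (negPf neq) eq_sym (negPf neq) !addn0.
by rewrite -!mulrnA mulnC.
Qed.

Lemma dir_deriv_is_linear v : linear (dir_deriv v).
Proof.
move=> a F G; rewrite /dir_deriv scaler_sumr -big_split; apply: eq_bigr => l _.
by rewrite linearP scalerDr !scalerA mulrC.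
Qed.

HB.instance Definition _ v := GRing.isLinear.Build K {fps K[n]} {fps K[n]} *:%R
  (dir_deriv v) (dir_deriv_is_linear v).

Lemma dir_derivP a u v F :
  dir_deriv (a *: u + v) F = a *: dir_deriv u F + dir_deriv v F.
Proof.
rewrite /dir_deriv scaler_sumr -big_split; apply: eq_bigr => l _.
by rewrite !mxE scalerDl scalerA.
Qed.

Lemma dir_derivC u v F : dir_deriv u (dir_deriv v F) = dir_deriv v (dir_deriv u F).
Proof.
rewrite /dir_deriv.
under eq_bigr do rewrite linear_sum scaler_sumr.
under [RHS]eq_bigr do rewrite linear_sum scaler_sumr.
rewrite exchange_big; apply: eq_bigr => l _; apply: eq_bigr => l' _.
by rewrite !linearZ /= !scalerA mulrC fps_derivC.
Qed.

Lemma iter_dir_deriv_is_linear vs : linear (iter_dir_deriv vs).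
Proof.
rewrite /iter_dir_deriv => a F G; elim: vs F G => //= v vs IHvs F G.
by rewrite linearP IHvs.
Qed.

HB.instance Definition _ vs := GRing.isLinear.Build K {fps K[n]} {fps K[n]} *:%R
  (iter_dir_deriv vs) (iter_dir_deriv_is_linear vs).

Lemma iter_dir_deriv_perm us vs F :
  perm_eq us vs -> iter_dir_deriv us F = iter_dir_deriv vs F.
Proof.
have cons_in v ws ws' G :
    iter_dir_deriv (v :: ws ++ ws') G = iter_dir_deriv (ws ++ v :: ws') G.
  elim: ws G => //= w ws IHws G; rewrite /iter_dir_deriv /= in IHws *.
  by rewrite dir_derivC IHws.
elim: us vs F => [|u us IHus] vs F; first by rewrite perm_sym => /perm_nilP ->.
move=> eq_vs; have u_vs: u \in vs by rewrite -(perm_mem eq_vs) mem_head.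
case/splitPr: vs / u_vs eq_vs => ws ws' eq_vs; rewrite -cons_in.
apply: IHus; rewrite -(perm_cons u) (permPl eq_vs).
by rewrite -cat_rcons -cat1s -cats1 catA perm_cat2r perm_catC.
Qed.

(* The constant term of F after derivation in the directions x 0, x 1, ... *)
Definition iter_deriv0 F k (x : {ffun 'I_k -> 'rV[K]_n}) : K^o :=
  fps_const_term (iter_dir_deriv [seq x i | i <- enum 'I_k] F).

Lemma iter_deriv0_multilinear F k : multilinear (@iter_deriv0 F k).
Proof.
move=> x i a u w; have := enum_uniq 'I_k; have: i \in enum 'I_k by rewrite mem_enum.
rewrite /iter_deriv0; case/splitPr => s s'; rewrite cat_uniq /= => uniq_s.
have /and3P[_ /norP[i_s _] /andP[i_s' _]] := uniq_s.
have upd t r : i \notin r -> [seq ffun_upd x i t j | j <- r] = map x r.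
  by move=> ir; apply/eq_in_map => j jr; rewrite ffunE (negPf (memPn ir j jr)).
rewrite !map_cat /= !ffunE eqxx !upd // /iter_dir_deriv !foldl_cat /=.
by rewrite dir_derivP -!/(iter_dir_deriv _ _) linearP.
Qed.

Lemma iter_deriv0_symmetric F k : symmetric_map (@iter_deriv0 F k).
Proof.
move=> x s; congr fps_const_term; apply: iter_dir_deriv_perm.
under eq_map do rewrite ffunE.
rewrite (map_comp x s); apply: perm_map; apply: uniq_perm.
- by rewrite map_inj_uniq ?enum_uniq //; apply: perm_inj.
- exact: enum_uniq.
- move=> i; rewrite mem_enum; apply/mapP; exists (s^-1 i)%g.
    by rewrite mem_enum.
  by rewrite permKV.
Qed.

Definition fps_deriv0 F k : {linear sym_power 'rV[K]_n k -> K^o} :=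
  sym_lift (@iter_deriv0_multilinear F k) (@iter_deriv0_symmetric F k).

Lemma fps_deriv0E F k (x : 'I_k -> 'rV[K]_n) :
  fps_deriv0 F k (sym_tensor x) =
  fps_const_term (iter_dir_deriv [seq x i | i <- enum 'I_k] F).
Proof.
rewrite /fps_deriv0 sym_liftE /iter_deriv0; congr (fps_const_term (iter_dir_deriv _ _)).
by apply: eq_map => i; rewrite ffunE.
Qed.

Context (m : nat) (f : smooth_map K n m) (k : nat).

Definition smooth_deriv_fun (t : sym_power 'rV[K]_n k) : 'rV[K]_m :=
  \row_j fps_deriv0 (smooth_component f j) k t.

Lemma smooth_deriv_is_linear : linear smooth_deriv_fun.
Proof. by move=> a t u; apply/rowP => j; rewrite !mxE linearP. Qed.

HB.instance Definition _ := GRing.isLinear.Build K (sym_power 'rV[K]_n k) 'rV[K]_m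
  *:%R smooth_deriv_fun smooth_deriv_is_linear.

Definition smooth_deriv0 : {linear sym_power 'rV[K]_n k -> 'rV[K]_m} :=
  smooth_deriv_fun.

End Derivatives.

(* Main.v *)
Require Import Defs.
From mathcomp Require Import all_boot all_algebra.
From HB Require Import structures.
From mathcomp Require Import topology mpoly.

Set Implicit Arguments.
Unset Strict Implicit.
Unset Printing Implicit Defensive.

Import GRing.Theory.
Local Open Scope ring_scope.

(** Fix a component G of g. Both sides of the formula make sense for every
    series G, and they are compared as linear functionals of G:
    - L_A(G), the constant term of the derivative of (G o f) in the directions
      v_i, i in A;
    - R_A(G), the sum over the partitions pi of A of the constant terms of the
      derivatives of G in the directions w_S = <f^(|S|)(0), (x)_(i in S) v_i>,
      S in pi.
    Every series is G = c + sum_j T_j H_j ([fps_factor]), so it is enough to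
    know how L and R behave on constants and under multiplication by T_j.

    On 1 both are 1 if A is empty and 0 otherwise. For T_j H, the Leibniz rule
    over subsets ([set_deriv0M]) applied to f_j (H o f) gives
      L_A(T_j H) = sum_(S <= A) <f_j^(|S|)(0), (x)_(i in S) v_i> L_(A - S)(H),
    where the empty S contributes nothing because f_j has zero constant term
    ([smooth_component_const_term], the only use of continuity). On the other
    side T_j is linear without constant term, so differentiating T_j H in the
    directions of a partition singles out one block S, with factor the j-th
    coordinate of w_S, and leaves a partition of A - S; hence
      R_A(T_j H) = sum_(S <= A, S nonempty) (w_S)_j R_(A - S)(H)
    ([partition_deriv0_varM]). The j-th coordinate of w_S is by definition the
    coefficient in the first formula, so L and R obey the same recursion, which
    strictly decreases A. No division takes place, whence the independence of
    the characteristic. *)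

(** * Leibniz rule and factorization in rings of series *)

Section Series.
Context (K : fieldType) (n : nat).
Implicit Types (F G : {fps K[n]}) (u : 'rV[K]_n).

Lemma const_termM F G :
  fps_const_term (F * G) = fps_const_term F * fps_const_term G.
Proof.
rewrite /fps_const_term (@fcoef_mul_trunc _ _ 1) ?mdeg0 //.
have -> (p q : {mpoly K[n]}) : (p * q)@_0%MM = p@_0%MM * q@_0%MM.
  exact: (rmorphM (mcoeff 0%MM)).
by rewrite !mcoeff_fps_trunc ?mdeg0.
Qed.

(** A coefficient of a product involves finitely many coefficients of the
    factors, so the rule is inherited from polynomials by truncation. The
    derivation consumes one degree, hence the order mdeg a + 2. *)
Lemma fps_derivM l F G :
  fps_deriv l (F * G) = fps_deriv l F * G + F * fps_deriv l G.
Proof.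
apply/fpsP => a; rewrite fcoefD [LHS]/(fcoef (F * G) (a + U_(l))%MM *+ (a l).+1).
pose d := (mdeg a).+2; pose p := fps_trunc d F; pose q := fps_trunc d G.
have trE H b : (mdeg b <= mdeg a)%N -> (fps_trunc d H)@_b = fcoef H b.
  by move=> le_ba; rewrite mcoeff_fps_trunc // ltnS leqW.
have dtrE H b : (mdeg b <= mdeg a)%N ->
    (fps_trunc d H)^`M(l)@_b = fcoef (fps_deriv l H) b.
  move=> le_ba; rewrite mcoeff_deriv /= mcoeff_fps_trunc //.
  by rewrite mdegD mdeg1 addn1.
transitivity ((p * q)^`M(l)@_a).
  rewrite mcoeff_deriv; congr (_ *+ _); apply: fcoef_mul_trunc.
  by rewrite mdegD mdeg1 addn1.
rewrite mderivM mcoeffD.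
by congr (_ + _); symmetry; apply: fcoef_mul; (exact: trE || exact: dtrE).
Qed.

Lemma fps_deriv_var (l j : 'I_n) : fps_deriv l (fps_var K j) = (l == j)%:R.
Proof.
apply/fpsP => a /=.
have -> : fcoef ((l == j)%:R : {fps K[n]}) a = ((l == j) && (a == 0%MM))%:R.
  by case: (l == j); rewrite ?fcoef1.
have -> : ((a + U_(l))%MM == U_(j)%MM) = (l == j) && (a == 0%MM).
  apply/eqP/andP => [aj|[/eqP-> /eqP->]]; last by rewrite add0m.
  have a0 : a == 0%MM.
    by rewrite -mdeg_eq0; move/(congr1 mdeg): aj; rewrite mdegD !mdeg1 addn1 => -[->].
  move: aj; rewrite (eqP a0) add0m => /mnmP/(_ l); rewrite !mnm1E eqxx.
  by rewrite eq_sym; case: (l == j).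
by case: (l == j) => //=; have [->|] := eqVneq a 0%MM; rewrite ?mul0rn // mnm0E.
Qed.

Lemma dir_derivM u F G :
  dir_deriv u (F * G) = dir_deriv u F * G + F * dir_deriv u G.
Proof.
rewrite /dir_deriv mulr_suml mulr_sumr -big_split; apply: eq_bigr => l _ /=.
by rewrite fps_derivM scalerDr scalerAl scalerAr.
Qed.

Lemma dir_deriv_var u j : dir_deriv u (fps_var K j) = (u 0 j)%:A.
Proof.
rewrite /dir_deriv (bigD1 j) //= big1 ?addr0 => [|l /negPf lj].
  by rewrite fps_deriv_var eqxx.
by rewrite fps_deriv_var lj scaler0.
Qed.

Lemma dir_deriv1 u : dir_deriv u (1 : {fps K[n]}) = 0.
Proof.
by have := dir_derivM u 1 1; rewrite !(mul1r, mulr1) -[LHS]addr0 => /addrI.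
Qed.

Lemma fcoef_varM j F a :
  fcoef (fps_var K j * F) a = if a j == 0%N then 0 else fcoef F (a - U_(j))%MM.
Proof.
have -> : fcoef (fps_var K j * F) a = (fps_trunc (mdeg a).+1 F * 'X_[U_(j)])@_a.
  rewrite mulrC; apply: fcoef_mul => b le_ba; first by rewrite mcoeff_fps_trunc.
  by rewrite mcoeffX eq_sym.
case: eqP => aj; last first.
  have /submK {1}<- : (U_(j) <= a)%MM by rewrite lep1mP; apply/eqP.
  by rewrite addmC mcoeffMX mcoeff_fps_trunc // ltnS mdegB.
rewrite mcoeffM big1 // => -[k1 k2] /= /eqP/mnmP/(_ j).
rewrite aj mnmDE mcoeffX; have [<-|_ _] := eqVneq; last by rewrite mulr0.
by rewrite mnm1E eqxx addn1.
Qed.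

(** Replaces expansions into monomials: induction on the number of derivatives
    needs only one variable to be split off, and no convergence question
    arises. *)
Lemma fps_factor F : exists H : 'I_n -> {fps K[n]},
  F = (fps_const_term F)%:A + \sum_j fps_var K j * H j.
Proof.
(* The monomial T^b is assigned to the first variable that occurs in it. *)
pose H j : {fps K[n]} := Fps (fun a =>
  if [pick i | (a + U_(j))%MM i != 0%N] == Some j
  then fcoef F (a + U_(j))%MM else 0).
exists H; apply/fpsP => a; rewrite fcoefD fcoef_sum.
under eq_bigr do rewrite fcoef_varM.
rewrite fcoefZ fcoef1; have [->|a0] := eqVneq a 0%MM.
  by rewrite mulr1 big1 ?addr0 // => j _; rewrite mnm0E.
have [i pick_i ai] : exists2 i, [pick i | a i != 0%N] = Some i & a i != 0%N.
  case: pickP => [i ai|none]; first by exists i.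
  by case/eqP: a0; apply/mnmP => i; rewrite mnm0E; have /negbFE/eqP := none i.
have HE j : a j != 0%N -> fcoef (H j) (a - U_(j))%MM
    = if [pick i | a i != 0%N] == Some j then fcoef F a else 0.
  by move=> aj; rewrite /= submK ?lep1mP.
rewrite mulr0 add0r (bigD1 i) // (negPf ai) HE // big1 => [|j ji].
  by rewrite pick_i eqxx /= addr0.
have [//|aj] := eqVneq; rewrite HE // pick_i.
by rewrite [_ == _]eq_sym -[_ == _]/(j == i) (negPf ji).
Qed.

End Series.

(** * Derivatives along a finite set of directions *)

Section SetDeriv.
Context (K : fieldType) (n : nat) (T : finType) (w : T -> 'rV[K]_n).
Implicit Types (F G : {fps K[n]}) (A B : {set T}).

Definition set_deriv A F : {fps K[n]} := iter_dir_deriv [seq w x | x <- enum A] F.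

HB.instance Definition _ A := GRing.isLinear.Build K {fps K[n]} {fps K[n]} *:%R
  (set_deriv A) (iter_dir_deriv_is_linear _).

Lemma set_deriv_set0 F : set_deriv set0 F = F.
Proof. by rewrite /set_deriv enum_set0. Qed.

Lemma set_derivU1 x A F : x \notin A ->
  set_deriv (x |: A) F = set_deriv A (dir_deriv (w x) F).
Proof.
move=> xA; rewrite /set_deriv -[RHS]/(iter_dir_deriv (map w (x :: enum A)) F).
apply/iter_dir_deriv_perm/perm_map/uniq_perm; rewrite ?enum_uniq //=.
  by rewrite mem_enum xA enum_uniq.
by move=> y; rewrite inE !mem_enum !inE.
Qed.

Lemma set_deriv1 A : set_deriv A 1 = (A == set0)%:R.
Proof.
have [->|[x xA]] := set_0Vmem A; first by rewrite set_deriv_set0 eqxx.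
rewrite -(setD1K xA) set_derivU1 ?setD11 // dir_deriv1 linear0.
by have [A0|//] := eqVneq; move: (setU11 x (A :\ x)); rewrite A0 inE.
Qed.

(** Each direction hits either F or G, and B collects those that hit F. The
    induction removes one x from A; the subsets of A with and without x
    correspond to the two terms of the Leibniz rule for the direction w x. *)
Lemma set_derivM A F G : set_deriv A (F * G) =
  \sum_(B : {set T} | B \subset A) set_deriv B F * set_deriv (A :\: B) G.
Proof.
have [k leAk] := ubnP #|A|; elim: k A leAk F G => // k IHk A leAk F G.
have [->|[x xA]] := set_0Vmem A.
  rewrite (big_pred1 set0) => [|B]; last by rewrite subset0.
  by rewrite setD0 !set_deriv_set0.
have ltAk : (#|A :\ x| < k)%N by rewrite (cardsD1 x) xA in leAk.
rewrite (bigID (fun B => x \in B)) /= -{1}(setD1K xA) set_derivU1 ?setD11 //.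
rewrite dir_derivM linearD /= !IHk //; congr (_ + _).
  rewrite [RHS](reindex_onto (fun B => x |: B) (fun B => B :\ x)) /=; last first.
    by move=> B /andP[_ xB]; rewrite setD1K.
  apply: eq_big => [B|B].
    rewrite subsetD1 subUset sub1set xA setU11 andbT /=; congr (_ && _).
    by apply/idP/eqP => [|<-]; [exact: setU1K | rewrite setD11].
  by rewrite subsetD1 => /andP[_ xB]; rewrite set_derivU1 // setDDl.
apply: eq_big => [B|B]; first by rewrite subsetD1.
rewrite subsetD1 => /andP[sBA xB].
rewrite -[in RHS](setD1K (_ : x \in A :\: B)) ?inE ?xB // set_derivU1 ?setD11 //.
by rewrite setDDl setUC -setDDl.
Qed.

(** At most one direction can hit the variable, since its first derivatives are
    constants. *)
Lemma set_deriv_varM A j G : set_deriv A (fps_var K j * G) =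
  fps_var K j * set_deriv A G + \sum_(x in A) w x 0 j *: set_deriv (A :\ x) G.
Proof.
have [k leAk] := ubnP #|A|; elim: k A leAk G => // k IHk A leAk G.
have [->|[x xA]] := set_0Vmem A.
  by rewrite big_set0 addr0 !set_deriv_set0.
have ltAk : (#|A :\ x| < k)%N by rewrite (cardsD1 x) xA in leAk.
rewrite -[in LHS](setD1K xA) set_derivU1 ?setD11 //.
rewrite dir_derivM dir_deriv_var -scalerAl mul1r linearD linearZ /= IHk //.
rewrite addrCA; congr (_ + _).
  by rewrite -{2}(setD1K xA) set_derivU1 ?setD11.
rewrite [RHS](bigD1 x) //=; congr (_ + _).
apply: eq_big => [y|y]; rewrite !inE 1?andbC // => /andP[yA yx].
have xAy : x \in A :\ y by rewrite !inE eq_sym yx.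
by rewrite -[in RHS](setD1K xAy) set_derivU1 ?setD11 // !setDDl setUC.
Qed.

Definition set_deriv0 A F : K^o := fps_const_term (set_deriv A F).

Lemma set_deriv0_is_linear A : linear (set_deriv0 A).
Proof. by move=> a F G; rewrite /set_deriv0 linearP. Qed.

HB.instance Definition _ A := GRing.isLinear.Build K {fps K[n]} K^o *:%R
  (set_deriv0 A) (set_deriv0_is_linear A).

Lemma set_deriv01 A : set_deriv0 A 1 = (A == set0)%:R.
Proof.
rewrite /set_deriv0 set_deriv1 /fps_const_term.
by case: eqP => // _; rewrite fcoef1 eqxx.
Qed.

Lemma set_deriv0M A F G : set_deriv0 A (F * G) =
  \sum_(B : {set T} | B \subset A) set_deriv0 B F * set_deriv0 (A :\: B) G.
Proof.
rewrite /set_deriv0 set_derivM /fps_const_term fcoef_sum.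
by apply: eq_bigr => B _; apply: const_termM.
Qed.

Lemma set_deriv0_varM A j G : set_deriv0 A (fps_var K j * G) =
  \sum_(x in A) w x 0 j * set_deriv0 (A :\ x) G.
Proof.
rewrite /set_deriv0 set_deriv_varM /fps_const_term fcoefD fcoef_sum.
by rewrite fcoef_varM mnm0E add0r.
Qed.

(** Links the symmetric tensor, indexed by ordinals, with the derivatives
    indexed by the set A itself. *)
Lemma fps_deriv0_bigtensor A F :
  fps_deriv0 F #|A| (\bigotimes_(x in A) w x) = set_deriv0 A F.
Proof.
rewrite /bigtensor fps_deriv0E /set_deriv0 /set_deriv.
congr fps_const_term; rewrite (map_comp w enum_val).
apply/iter_dir_deriv_perm/perm_map/uniq_perm; rewrite ?enum_uniq //.
  by rewrite (map_inj_uniq enum_val_inj) enum_uniq.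
move=> x; rewrite mem_enum; apply/mapP/idP => [[i _ ->]|xA]; first exact: enum_valP.
by exists (enum_rank_in xA x); rewrite ?mem_enum // enum_rankK_in.
Qed.

End SetDeriv.

(** * The sum over partitions *)

Section PartitionDeriv.
Context (K : fieldType) (m : nat) (T : finType) (w : {set T} -> 'rV[K]_m).
Implicit Types (G : {fps K[m]}) (A : {set T}).

Definition partition_deriv0 A G : K^o :=
  \sum_(pi : {set {set T}} | partition pi A) set_deriv0 w pi G.

Lemma partition_deriv0_is_linear A : linear (partition_deriv0 A).
Proof.
move=> a F G; rewrite /partition_deriv0 scaler_sumr -big_split.
by apply: eq_bigr => pi _; rewrite linearP.
Qed.

HB.instance Definition _ A := GRing.isLinear.Build K {fps K[m]} K^o *:%R
  (partition_deriv0 A) (partition_deriv0_is_linear A).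

Lemma partition_deriv01 A : partition_deriv0 A 1 = (A == set0)%:R.
Proof.
rewrite /partition_deriv0; under eq_bigr do rewrite set_deriv01.
have [->|A0] := eqVneq A set0.
  by rewrite (big_pred1 set0) ?eqxx // => pi; rewrite partition_set0.
rewrite big1 // => pi piA; case: eqP => // pi0.
by case/eqP: A0; rewrite -(cover_partition piA) pi0 /cover big_set0.
Qed.

(** The pairs of a partition pi of A and a block S of pi correspond to the pairs
    of a nonempty S included in A and a partition of the complement of S in A:
    remove S from pi, or add it back. *)
Lemma partition_deriv0_varM A j G : partition_deriv0 A (fps_var K j * G) =
  \sum_(S : {set T} | (S \subset A) && (S != set0))
    w S 0 j * partition_deriv0 (A :\: S) G.
Proof.
rewrite /partition_deriv0; under eq_bigr do rewrite set_deriv0_varM.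
rewrite (exchange_big_dep (fun S : {set T} => (S \subset A) && (S != set0))) /=; last first.
  by move=> pi S piA Spi; rewrite (partitionS piA) ?(partition_neq0 piA).
apply: eq_bigr => S /andP[sSA S0]; rewrite mulr_sumr.
rewrite (reindex_onto (fun pi => S |: pi) (fun pi => pi :\ S)) /=; last first.
  by move=> pi /andP[_ Spi]; rewrite setD1K.
apply: eq_big => [pi|pi /andP[_ /eqP->] //].
rewrite setU11 andbT; apply/andP/idP => [[piA /eqP <-]|piA].
  by rewrite (partitionD1 piA) ?setU11.
have Spi : S \notin pi.
  apply/negP => /(partitionS piA); rewrite subsetD => /andP[_].
  by rewrite -setI_eq0 setIid (negPf S0).
rewrite setU1K // eqxx; split=> //.
rewrite -(setID A S) (setIidPr sSA); apply: partitionU1 => //.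
by rewrite -setI_eq0 setIDA setIC setDIl setDv setI0.
Qed.

End PartitionDeriv.

(** * Pulling back along a smooth mapping *)

Section FaaDiBruno.
Context (K : fieldType) (n m : nat) (f : smooth_map K n m).

(** By continuity at 0, the pullback of some power T_j^r with r > 0 has zero
    constant term; this constant term is the r-th power of that of f_j. *)
Lemma smooth_component_const_term j : fps_const_term (smooth_component f j) = 0.
Proof.
have nbM : nbhs (pullback f 0) (@fps_max_ideal K n).
  exists 1%N => // G [s Ms ->]; rewrite rmorph0 add0r.
  rewrite -[fps_max_ideal _]/(fps_const_term _ = 0) /fps_const_term fcoef_sum.
  rewrite big_seq big1 // => -[a t] /Ms; case/tupleP: t => y t My.
  rewrite -/(fps_const_term _) big_cons !const_termM.
  by rewrite (My y (mem_head _ _)) mul0r mulr0.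
have [r r_gt0 Mr] := @pullback_continuous _ _ _ f 0 _ nbM.
have /Mr : ideal_power (@fps_max_ideal K m) r (fps_var K j ^+ r).
  exists [:: (1, [tuple of nseq r (fps_var K j)])] => [p|].
    rewrite inE => /eqP -> y /nseqP[-> _].
    by rewrite /fps_max_ideal /= /fps_const_term /= eq_sym mnm1_eq0.
  by rewrite big_seq1 /= mul1r big_nseq -Monoid.iteropE.
rewrite /fps_max_ideal /= add0r rmorphXn /= => /eqP.
have -> (F : {fps K[n]}) : fps_const_term (F ^+ r) = fps_const_term F ^+ r.
  elim: r {r_gt0 Mr} => [|r IHr]; first by rewrite /fps_const_term fcoef1 eqxx.
  by rewrite !exprS const_termM IHr.
by rewrite expf_eq0 r_gt0 => /eqP.
Qed.

Variables (T : finType) (v : T -> 'rV[K]_n).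

(** The formula for an arbitrary series G, by induction on the cardinality of A.
    G is universally quantified in the induction because the recursion passes
    from G to its factors H j. *)
Lemma set_deriv0_pullback (A : {set T}) (G : {fps K[m]}) :
  set_deriv0 v A (pullback f G) =
  partition_deriv0
    (fun S => smooth_deriv0 f #|S| (\bigotimes_(i in S) v i)) A G.
Proof.
have [k leAk] := ubnP #|A|; elim: k A leAk G => // k IHk A leAk G.
have [H ->] := fps_factor G; rewrite !linearD !linearZ /= rmorph1.
rewrite set_deriv01 partition_deriv01; congr (_ + _).
rewrite !linear_sum; apply: eq_bigr => j _ /=.
rewrite rmorphM set_deriv0M partition_deriv0_varM.
(* The empty subset contributes the constant term of f_j, which vanishes. *)
rewrite (bigD1 set0) ?sub0set //= {1}/set_deriv0 set_deriv_set0.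
rewrite smooth_component_const_term mul0r add0r.
apply: eq_bigr => S /andP[sSA S0]; rewrite mxE fps_deriv0_bigtensor (IHk (A :\: S)) //.
rewrite (leq_trans _ (leAk : #|A| <= k)%N) // cardsD (setIidPr sSA).
by rewrite ltn_subrL !card_gt0 S0; apply: contraNneq S0 => A0; rewrite -subset0 -A0.
Qed.
End FaaDiBruno.

Theorem mainTheorem2 (K : fieldType) (n m p : nat)
    (f : smooth_map K n m) (g : smooth_map K m p)
    (T : finType) (I : {set T}) (v : T -> 'rV[K]_n) :
  smooth_deriv0 (smooth_comp g f) #|I| (\bigotimes_(i in I) v i) =
  \sum_(pi : {set {set T}} | partition pi I)
    smooth_deriv0 g #|pi| (\bigotimes_(S in pi)
      smooth_deriv0 f #|S| (\bigotimes_(i in S) v i)).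
Proof.
apply/rowP => j; rewrite summxE !mxE fps_deriv0_bigtensor.
rewrite [LHS](set_deriv0_pullback f); apply: eq_bigr => pi _.
by rewrite mxE fps_deriv0_bigtensor.
Qed.
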